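(* Let $d,n\in\mathbb{N}$. There exists an index-invariant property $\mathcal{P}_{\mathsf{vc}}$ of distributions over $\{0,1\}^n$ with VC-dimension at most $d$ such that any (non-adaptive) tester for $\mathcal{P}_{\mathsf{vc}}$ requires $2^{\Omega(d)}$ samples and $2^{2^{d-\mathcal{O}(1)}}$ queries.
   Context: Huge object model: a tester for a property $\mathcal{P}$ (a closed set of distributions over $\{0,1\}^n$) gets independent samples from an unknown $D$ and queries individual coordinates of samples; with probability at least $2/3$ it accepts every $D\in\mathcal{P}$ and rejects every $D$ that is $\varepsilon$-far from $\mathcal{P}$ (Earth Mover Distance w.r.t. normalized Hamming distance greater than $\varepsilon$ from every member of $\mathcal{P}$), for a fixed proximity parameter $\varepsilon$. Non-adaptive: queried coordinates are fixed in advance from the random coins. For a permutation $\sigma$ of $[n]$, $D_\sigma$ satisfies $D(w_1,\dots,w_n)=D_\sigma(w_{\sigma(1)},\dots,w_{\sigma(n)})$; $\mathcal{P}$ is index-invariant if $D\in\mathcal{P}\iff D_\sigma\in\mathcal{P}$. The VC-dimension of $V\subseteq\{0,1\}^n$ is the largest size of an index sequence $(i_1,\dots,i_k)$ with $\{(v_{i_1},\dots,v_{i_k}):v\in V\}=\{0,1\}^k$; a property has VC-dimension at most $d$ if the support of each of its members has VC-dimension at most $d$.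
   Formalization: The claim is proved for n at least 2^(2^d), since for arbitrary d and n it fails (e.g. n = 1 with d large), and for every proximity parameter ε in (0, ε0], where ε0 > 0 is an absolute constant, since for ε ≥ 1 no distribution is far. *)

(* Defs.v *)
From HB Require Import structures.
From mathcomp Require Import all_boot all_order all_algebra perm.
From mathcomp Require Import all_classical all_reals all_analysis.

Set Implicit Arguments.
Unset Strict Implicit.
Unset Printing Implicit Defensive.

Import Order.TTheory GRing.Theory Num.Theory.
Import numFieldNormedType.Exports.

Local Open Scope ring_scope.

Notation cube n := {ffun 'I_n -> bool}.

Record fdist (R : realType) (T : finType) := FDist {
  pmf :> {ffun T -> R};
  fdistP : [forall x, 0 <= pmf x] && (\sum_x pmf x == 1) }.

HB.instance Definition _ (R : realType) (T : finType) :=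
  [isSub for @pmf R T].

Definition support (R : realType) (T : finType) (D : fdist R T) : {set T} :=
  [set x | D x != 0].

(** ** Earth Mover Distance *)

(* [hamming x y] is the normalized Hamming distance; its value for [n = 0] is
   the junk value [0 / 0 = 0]. *)
Definition hamming (R : realType) (n : nat) (x y : cube n) : R :=
  #|[set i | x i != y i]|%:R / n%:R.

Definition coupling (R : realType) (T : finType) (D1 D2 : fdist R T)
    (g : fdist R (T * T)%type) : Prop :=
  (forall x, \sum_y g (x, y) = D1 x) /\ (forall y, \sum_x g (x, y) = D2 y).

Definition transport_cost (R : realType) (n : nat)
    (g : fdist R (cube n * cube n)%type) : R :=
  \sum_p g p * hamming R p.1 p.2.

Definition emd (R : realType) (n : nat) (D1 D2 : fdist R (cube n)) : R :=
  inf [set transport_cost g | g in coupling D1 D2]%classic.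

(** ** Properties *)

(* [{ptws cube n -> R}] carries the topology of pointwise convergence, i.e. the
   Euclidean topology of [R ^ (2 ^ n)]. *)
Definition pmf_ptws (R : realType) (n : nat) (D : fdist R (cube n)) :
  {ptws cube n -> R} := fun x => D x.

Definition closed_property (R : realType) (n : nat)
    (P : set (fdist R (cube n))) : Prop :=
  closed [set pmf_ptws D | D in P]%classic.

Definition far (R : realType) (n : nat) (eps : R)
    (P : set (fdist R (cube n))) (D : fdist R (cube n)) : Prop :=
  forall D', P D' -> eps < emd D D'.

Definition perm_cube (n : nat) (sigma : {perm 'I_n}) (w : cube n) : cube n :=
  [ffun i => w (sigma i)].

Lemma perm_cubeK (n : nat) (sigma : {perm 'I_n}) :
  cancel (perm_cube sigma) (perm_cube sigma^-1%g).
Proof. by move=> w; apply/ffunP => i; rewrite !ffunE permKV. Qed.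

Lemma perm_cubeVK (n : nat) (sigma : {perm 'I_n}) :
  cancel (perm_cube sigma^-1%g) (perm_cube sigma).
Proof. by move=> w; apply/ffunP => i; rewrite !ffunE permK. Qed.

Lemma perm_dist_subproof (R : realType) (n : nat) (D : fdist R (cube n))
    (sigma : {perm 'I_n}) :
  let f := [ffun v => D (perm_cube sigma^-1%g v)] in
  [forall x, 0 <= f x] && (\sum_x f x == 1).
Proof.
have /andP[/forallP D0 /eqP D1] := fdistP D.
apply/andP; split; first by apply/forallP => x; rewrite ffunE.
rewrite (reindex (perm_cube sigma)) /=; last first.
  by exists (perm_cube sigma^-1%g) => x _; rewrite ?perm_cubeK ?perm_cubeVK.
by rewrite -D1; apply/eqP/eq_bigr => x _; rewrite ffunE perm_cubeK.
Qed.

Definition perm_dist (R : realType) (n : nat) (D : fdist R (cube n))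
    (sigma : {perm 'I_n}) : fdist R (cube n) :=
  FDist (perm_dist_subproof D sigma).

(* D (w_1, ..., w_n) = D_sigma (w_(sigma 1), ..., w_(sigma n)) *)
Lemma perm_distE (R : realType) (n : nat) (D : fdist R (cube n))
    (sigma : {perm 'I_n}) (w : cube n) :
  D w = perm_dist D sigma (perm_cube sigma w).
Proof. by rewrite ffunE perm_cubeK. Qed.

Definition index_invariant (R : realType) (n : nat)
    (P : set (fdist R (cube n))) : Prop :=
  forall (sigma : {perm 'I_n}) (D : fdist R (cube n)),
    P D <-> P (perm_dist D sigma).

(** ** VC-dimension *)

Definition shatters (n : nat) (V : {set cube n}) (k : nat)
    (t : k.-tuple 'I_n) : bool :=
  [set [ffun j : 'I_k => v (tnth t j)] | v : cube n in V] == [set: {ffun 'I_k -> bool}].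

(* The bound [k <= n] in the maximum is harmless, see [leq_vc_dim]. *)
Definition vc_dim (n : nat) (V : {set cube n}) : nat :=
  \max_(k < n.+1 | [exists t : k.-tuple 'I_n, shatters V t]) k.

Lemma leq_vc_dim (n : nat) (V : {set cube n}) (k : nat) (t : k.-tuple 'I_n) :
  shatters V t -> (k <= vc_dim V)%N.
Proof.
move=> shVt.
have t_inj : injective (tnth t).
  move=> i j eq_ij; apply/eqP/negPn/negP => neq_ij.
  have : [ffun l => l == i] \in [set: {ffun 'I_k -> bool}] by rewrite inE.
  rewrite -(eqP shVt) => /imsetP[v _ /ffunP E].
  have := E i; have := E j; rewrite !ffunE eqxx eq_ij => <-.
  by rewrite eq_sym (negbTE neq_ij).
have ltkn : (k < n.+1)%N.
  by rewrite ltnS -[k]card_ord -[n in (_ <= n)%N]card_ord (leq_card _ t_inj).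
apply: (@leq_bigmax_cond _ _ _ (Ordinal ltkn)).
by apply/existsP; exists t.
Qed.

Definition property_vc_dim_le (R : realType) (n : nat)
    (P : set (fdist R (cube n))) (d : nat) : Prop :=
  forall D, P D -> (vc_dim (support D) <= d)%N.

(** ** Non-adaptive testers in the huge object model *)

(* A tester taking [s] samples and making at most [q] queries in total; the
   query [(i, j)] reads coordinate [j] of the [i]-th sample.  The set of queries
   depends only on the coins.  Finitely many coin outcomes suffice, since only
   the pair (query set, decision function) determined by the coins matters and
   there are finitely many such pairs. *)
Record tester (R : realType) (n s q : nat) := Tester {
  coins : finType;
  coin_dist : fdist R coins;
  queries : coins -> {set 'I_s * 'I_n};
  queries_le : forall r, (#|queries r| <= q)%N;
  decide : coins -> {ffun 'I_s * 'I_n -> option bool} -> bool }.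

Definition answers (n s : nat) (Q : {set 'I_s * 'I_n})
    (w : {ffun 'I_s -> cube n}) : {ffun 'I_s * 'I_n -> option bool} :=
  [ffun p => if p \in Q then Some (w p.1 p.2) else None].

(* The probability, over the coins and [s] independent samples from [D], that
   the tester outputs [b]. *)
Definition output_prob (R : realType) (n s q : nat) (T : tester R n s q)
    (D : fdist R (cube n)) (b : bool) : R :=
  \sum_(r : coins T) \sum_(w : {ffun 'I_s -> cube n})
     coin_dist T r * (\prod_(i < s) D (w i)) *
     (decide r (answers (queries r) w) == b)%:R.

Definition is_tester (R : realType) (n s q : nat) (eps : R)
    (P : set (fdist R (cube n))) (T : tester R n s q) : Prop :=
  (forall D, P D -> 2 / 3 <= output_prob T D true) /\
  (forall D, far eps P D -> 2 / 3 <= output_prob T D false).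

(* Main.v *)
Require Import Defs.
From HB Require Import structures.
From mathcomp Require Import all_boot all_order all_algebra perm.
From mathcomp Require Import all_classical all_reals all_analysis.
From mathcomp Require Import ring lra zify.

(* Let k = 2^d and t = 2^(k/8) (d + 1 for small d).  The property consists
   of the uniform distributions on the rows of the k x n matrices with at most t
   distinct columns, i.e. the matrices (i, j) |-> M (i, tau j) with M a k x t
   matrix.
   Supports have at most k points, so the VC-dimension is at most d.

   Samples: average over M with tau j = j mod t.  Unless two of the inspected
   samples are the same row, the tester sees independent random t-bit strings
   spread over the blocks of tau, as it would on the uniform distribution over
   all such strings, which is far from every distribution with k support points.

   Queries: average over M and tau.  Unless two of the queried columns have the
   same type, the tester cannot tell the matrix from a uniformly random k x n
   matrix, which by a first-moment bound over all (M, tau) is far from the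
   property with high probability.

   The second comparison is the first one with rows and columns exchanged. *)

Set Implicit Arguments.
Unset Strict Implicit.
Unset Printing Implicit Defensive.

Import Order.TTheory GRing.Theory Num.Theory.
Import numFieldNormedType.Exports.

Local Open Scope ring_scope.

(** * Averages over finite types *)

Definition mean (R : realType) (T : finType) (F : T -> R) : R :=
  (\sum_x F x) / #|T|%:R.

Lemma eq_mean (R : realType) (T : finType) (F G : T -> R) :
  F =1 G -> mean F = mean G.
Proof. by move=> FG; congr (_ / _); apply: eq_bigr => x _. Qed.

Lemma le_mean (R : realType) (T : finType) (F G : T -> R) :
  (forall x, F x <= G x) -> mean F <= mean G.
Proof. by move=> FG; apply: ler_wpM2r; rewrite ?invr_ge0// ler_sum. Qed.

Lemma meanD (R : realType) (T : finType) (F G : T -> R) :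
  mean (fun x => F x + G x) = mean F + mean G.
Proof. by rewrite /mean big_split mulrDl. Qed.

Lemma meanZ (R : realType) (T : finType) (a : R) (F : T -> R) :
  mean (fun x => a * F x) = a * mean F.
Proof. by rewrite /mean -mulr_sumr mulrA. Qed.

Lemma mean_cst (R : realType) (T : finType) (a : R) :
  (0 < #|T|)%N -> mean (fun _ : T => a) = a.
Proof.
by move=> T0; rewrite /mean sumr_const -[a *+ _]mulr_natr mulfK// pnatr_eq0 -lt0n.
Qed.

Lemma mean_sum (R : realType) (T I : finType) (F : T -> I -> R) :
  mean (fun x => \sum_i F x i) = \sum_i mean (F^~ i).
Proof. by rewrite /mean exchange_big /= mulr_suml. Qed.

Lemma exchange_mean (R : realType) (T U : finType) (F : T -> U -> R) :
  mean (fun x => mean (F x)) = mean (fun y => mean (F^~ y)).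
Proof.
by rewrite /mean -!mulr_suml exchange_big /= mulrAC.
Qed.

Lemma reindex_mean (R : realType) (T U : finType) (h : U -> T) (F : T -> R) :
  bijective h -> mean F = mean (F \o h).
Proof.
move=> h_bij; rewrite /mean (bij_eq_card h_bij) (reindex h) //.
exact: onW_bij.
Qed.

Lemma le_mean_cst (R : realType) (T : finType) (a : R) (F : T -> R) :
  (0 < #|T|)%N -> (forall x, F x <= a) -> mean F <= a.
Proof. by move=> T0 Fa; rewrite -[leRHS](mean_cst _ T0) le_mean. Qed.

Lemma le_cst_mean (R : realType) (T : finType) (a : R) (F : T -> R) :
  (0 < #|T|)%N -> (forall x, a <= F x) -> a <= mean F.
Proof. by move=> T0 Fa; rewrite -[leLHS](mean_cst _ T0) le_mean. Qed.

Lemma card_ffun_bool_gt0 (A : finType) : (0 < #|{ffun A -> bool}|)%N.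
Proof. by rewrite card_ffun card_bool expn_gt0. Qed.

(** * Random bit tables read through an index map *)

Definition ecomp (A B : finType) (M : {ffun B -> bool}) (kappa : A -> B) :
  {ffun A -> bool} := [ffun a => M (kappa a)].

Section Swap.
Variables (A B : finType) (kappa : A -> B) (S : {set A}).

Definition swap (p : {ffun A -> bool} * {ffun B -> bool}) :=
  ([ffun a => if a \in S then p.2 (kappa a) else p.1 a],
   [ffun b => if [pick a in S | kappa a == b] is Some a then p.1 a else p.2 b]).

(** Injectivity on [S] forces the [pick] to return the very point of [S] whose value was
    exchanged. *)
Lemma swapK : {in S &, injective kappa} -> involutive swap.
Proof.
move=> kappa_inj [X M]; congr (_, _); apply/ffunP => a; rewrite !ffunE /=.
  case: ifP => aS; last by rewrite aS.
  case: pickP => [a' /andP[a'S /eqP/kappa_inj ->//]|/(_ a)].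
  by rewrite aS eqxx.
by case: pickP => [a' /andP[a'S /eqP <-]|]; rewrite ?ffunE ?a'S.
Qed.

(* Exchanging the values on [S] of a matrix [X] on [A] with those of a matrix
   [M] on [B] along [kappa] is an involution of the pairs [(X, M)]. *)
Lemma mean_ecomp (R : realType) (Phi : {ffun A -> bool} -> R) :
  {in S &, injective kappa} ->
  (forall X Y : {ffun A -> bool}, {in S, X =1 Y} -> Phi X = Phi Y) ->
  mean (fun M => Phi (ecomp M kappa)) = mean Phi.
Proof.
move=> kappa_inj PhiS.
have A0 : (0 < #|{ffun A -> bool}|)%N by exact: card_ffun_bool_gt0.
have B0 : (0 < #|{ffun B -> bool}|)%N by exact: card_ffun_bool_gt0.
have EA : \sum_(X : {ffun A -> bool}) \sum_M Phi (ecomp M kappa) =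
          \sum_(X : {ffun A -> bool}) \sum_(M : {ffun B -> bool}) Phi X.
  rewrite !pair_bigA [RHS](reindex_inj (inv_inj (swapK kappa_inj))) /=.
  apply: eq_bigr => -[X M] _; apply: PhiS => a aS.
  by rewrite !ffunE aS.
have : #|{ffun A -> bool}|%:R * \sum_M Phi (ecomp M kappa) =
       #|{ffun B -> bool}|%:R * \sum_X Phi X.
  rewrite [LHS]mulr_natl -sumr_const EA mulr_sumr.
  by apply: eq_bigr => X _; rewrite sumr_const mulr_natl.
rewrite /mean => E.
have a0 : #|{ffun A -> bool}|%:R != 0 :> R by rewrite pnatr_eq0 -lt0n.
have b0 : #|{ffun B -> bool}|%:R != 0 :> R by rewrite pnatr_eq0 -lt0n.
by apply/(mulfI a0); rewrite mulrA E mulrAC divff// mul1r [RHS]mulrC divfK.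
Qed.
End Swap.

(** Whenever [kappa c] is injective on [S], the inner mean equals [mean Phi]; for every other [c] it
    is at most 1. The excess is thus at most the collision probability. *)
Lemma mean_ecomp_le (R : realType) (K A B : finType) (kappa : K -> A -> B)
    (S : {set A}) (Phi : {ffun A -> bool} -> R) :
  (0 < #|K|)%N ->
  (forall X, 0 <= Phi X <= 1) ->
  (forall X Y : {ffun A -> bool}, {in S, X =1 Y} -> Phi X = Phi Y) ->
  mean (fun c => mean (fun M => Phi (ecomp M (kappa c)))) <=
  mean Phi + mean (fun c => (~~ [forall a in S, forall a' in S,
     (kappa c a == kappa c a') ==> (a == a')])%:R).
Proof.
move=> K0 Phi01 PhiS.
rewrite -[X in X + _](mean_cst _ K0) -meanD; apply: le_mean => c.
case: (boolP [forall _ in _, _]) => [inj|_] /=.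
  rewrite addr0 (mean_ecomp (S := S))// => a a' aS a'S E.
  move/forall_inP/(_ a aS)/forall_inP/(_ a' a'S): inj.
  by rewrite E eqxx /= => /eqP.
have Phi0 : 0 <= mean Phi.
  apply: le_cst_mean (card_ffun_bool_gt0 A) _ => X.
  by have /andP[] := Phi01 X.
have : mean (fun M => Phi (ecomp M (kappa c))) <= 1.
  apply: le_mean_cst (card_ffun_bool_gt0 B) _ => M.
  by have /andP[] := Phi01 (ecomp M (kappa c)).
lra.
Qed.

(** * Collisions of a random function *)

(** The value at [a] is resampled: exchanging [f a] with a fresh uniform [c] is an involution of the
    pairs, and it turns the event into [c = f b]. *)
Lemma mean_ffun_eq (R : realType) (L I : finType) (a b : L) :
  (0 < #|I|)%N -> a != b ->
  mean (fun f : {ffun L -> I} => (f a == f b)%:R) = #|I|%:R^-1 :> R.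
Proof.
move=> I0 neq_ab.
pose h (p : {ffun L -> I} * I) := ([ffun l => if l == a then p.2 else p.1 l], p.1 a).
have hK : involutive h.
  move=> [f c]; congr (_, _); last by rewrite ffunE eqxx.
  by apply/ffunP => l; rewrite !ffunE /=; case: eqP => [->|].
have E : \sum_(f : {ffun L -> I}) \sum_(c : I) (f a == f b)%:R =
         #|{ffun L -> I}|%:R :> R.
  rewrite pair_big /= (reindex_inj (inv_inj hK)) /=.
  rewrite -(pair_big xpredT xpredT (fun (p : {ffun L -> I}) (c : I) =>
    ((h (p, c)).1 a == (h (p, c)).1 b)%:R)) /= -sumr_const.
  apply: eq_bigr => f _; rewrite (bigD1 (f b)) //= big1 ?addr0.
    by rewrite !ffunE eqxx (eq_sym b a) (negbTE neq_ab) eqxx.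
  by move=> c /negbTE cfb; rewrite !ffunE eqxx (eq_sym b a) (negbTE neq_ab) cfb.
have n0 : #|I|%:R != 0 :> R by rewrite pnatr_eq0 -lt0n.
have F0 : #|{ffun L -> I}|%:R != 0 :> R.
  by rewrite pnatr_eq0 -lt0n card_ffun expn_gt0 I0.
apply: (mulfI n0); rewrite divff// /mean mulrA mulr_sumr.
rewrite (eq_bigr (fun f : {ffun L -> I} => \sum_(c : I) (f a == f b)%:R));
  first by rewrite E divff.
by move=> f _; rewrite sumr_const mulr_natl.
Qed.

(** Union bound over the ordered pairs of distinct elements of [J]. *)
Lemma birthday (R : realType) (L I : finType) (J : {set L}) :
  (0 < #|I|)%N ->
  mean (fun f : {ffun L -> I} =>
    (~~ [forall a in J, forall b in J, (f a == f b) ==> (a == b)])%:R)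
  <= (#|J| * #|J|.-1)%:R / #|I|%:R :> R.
Proof.
move=> I0.
have -> : (#|J| * #|J|.-1)%:R / #|I|%:R =
    \sum_(a in J) \sum_(b in J :\ a)
      mean (fun f : {ffun L -> I} => (f a == f b)%:R) :> R.
  rewrite -sum_nat_const natr_sum mulr_suml; apply: eq_bigr => a aJ.
  rewrite (eq_bigr (fun=> #|I|%:R^-1)) => [|b].
    by rewrite sumr_const mulr_natl (cardsD1 a J) aJ.
  by rewrite !inE => /andP[ba _]; rewrite mean_ffun_eq// eq_sym.
under eq_bigr => a _ do rewrite /mean -mulr_suml exchange_big /=.
rewrite -mulr_suml exchange_big /=; apply: le_mean => f.
case: (boolP [forall _ in _, _]) => [_|]; first by do 2!apply: sumr_ge0 => ? _.
rewrite negb_forall => /existsP[a]; rewrite negb_imply => /andP[aJ].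
rewrite negb_forall => /existsP[b]; rewrite !negb_imply => /and3P[bJ fab ab].
rewrite (bigD1 a)//= (bigD1 b)/= ?fab; last by rewrite !inE eq_sym ab.
by rewrite -[leLHS]addr0 -addrA lerD2l addr_ge0 ?sumr_ge0// => i _; rewrite sumr_ge0.
Qed.

(** * Uniform distributions on indexed families of points, with multiplicity *)

Lemma emp_subproof (R : realType) (n : nat) (I : finType) (I0 : (0 < #|I|)%N)
    (phi : I -> cube n) :
  let f := [ffun x => mean (fun i => (phi i == x)%:R)] : {ffun cube n -> R} in
  [forall x, 0 <= f x] && (\sum_x f x == 1).
Proof.
apply/andP; split.
  by apply/forallP => x; rewrite ffunE; apply: le_cst_mean.
apply/eqP; under eq_bigr => x _ do rewrite ffunE.
rewrite -mean_sum -[RHS](mean_cst _ I0); apply: eq_mean => i.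
by rewrite (bigD1 (phi i))//= eqxx big1 ?addr0// => x /negbTE; rewrite eq_sym => ->.
Qed.

Definition emp (R : realType) (n : nat) (I : finType) (I0 : (0 < #|I|)%N)
  (phi : I -> cube n) : fdist R (cube n) := FDist (emp_subproof R I0 phi).

Lemma sum_emp (R : realType) (n : nat) (I : finType) (I0 : (0 < #|I|)%N)
    (phi : I -> cube n) (F : cube n -> R) :
  \sum_x emp R I0 phi x * F x = mean (F \o phi).
Proof.
under eq_bigr => x _ do rewrite ffunE mulrC -meanZ.
rewrite -mean_sum; apply: eq_mean => i.
rewrite (bigD1 (phi i))//= eqxx mulr1 big1 ?addr0// => x /negbTE.
by rewrite eq_sym => ->; rewrite mulr0.
Qed.

Lemma emp_neq0 (R : realType) (n : nat) (I : finType) (I0 : (0 < #|I|)%N)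
    (phi : I -> cube n) (x : cube n) :
  emp R I0 phi x != 0 -> exists i, x = phi i.
Proof.
rewrite ffunE; apply: contra_neqP => /forallNP nex.
rewrite -[RHS](mean_cst _ I0); apply: eq_mean => i.
by case: eqP => // E; case: (nex i).
Qed.

(** Independent samples amount to independent uniform indices: expanding the product of means shows
    that the probability of [w] is the fraction of index sequences yielding [w]. *)
Lemma sum_prod_emp (R : realType) (n s : nat) (I : finType) (I0 : (0 < #|I|)%N)
    (phi : I -> cube n) (G : {ffun 'I_s -> cube n} -> R) :
  \sum_(w : {ffun 'I_s -> cube n}) (\prod_(i < s) emp R I0 phi (w i)) * G w =
  mean (fun iota : {ffun 'I_s -> I} => G [ffun l => phi (iota l)]).
Proof.
have E (w : {ffun 'I_s -> cube n}) : \prod_i emp R I0 phi (w i) =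
    mean (fun iota : {ffun 'I_s -> I} => ([ffun l => phi (iota l)] == w)%:R).
  under eq_bigr => i _ do rewrite ffunE.
  rewrite /mean big_split/= bigA_distr_bigA/= prodr_const.
  rewrite card_ffun natrX exprVn; congr (_ / _).
  apply: eq_bigr => iota _.
  have [<-|neq] := eqVneq; first by rewrite big1// => i _; rewrite ffunE eqxx.
  have /existsP[i ni] : [exists i, phi (iota i) != w i].
    rewrite -negb_forall; apply: contra neq => /forallP E.
    by apply/eqP/ffunP => i; rewrite ffunE; apply/eqP/E.
  by rewrite (bigD1 i)//= (negbTE ni) mul0r.
under eq_bigr => w _ do rewrite E mulrC -meanZ.
rewrite -mean_sum; apply: eq_mean => iota.
rewrite (bigD1 [ffun l => phi (iota l)])//= eqxx mulr1 big1 ?addr0// => w /negbTE.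
by rewrite eq_sym => ->; rewrite mulr0.
Qed.

(** * Testers run on such distributions *)

Section Testers.
Variables (R : realType) (n s q : nat) (T : tester R n s q).

Definition outputs (b : bool) (r : coins T) (w : {ffun 'I_s -> cube n}) : R :=
  (decide r (answers (queries r) w) == b)%:R.

(** Non-adaptivity enters here: the queries are determined by [r] alone, so all other entries may be
    altered freely. *)
Lemma outputs_local b r (w w' : {ffun 'I_s -> cube n}) :
  {in queries r, forall p, w p.1 p.2 = w' p.1 p.2} ->
  outputs b r w = outputs b r w'.
Proof.
move=> eqw; rewrite /outputs; congr (decide _ _ == _)%:R.
by apply/ffunP => p; rewrite !ffunE; case: ifP => // pQ; rewrite eqw.
Qed.

Lemma output_prob_emp (I : finType) (I0 : (0 < #|I|)%N) (phi : I -> cube n) b :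
  output_prob T (emp R I0 phi) b = \sum_r coin_dist T r *
    mean (fun iota : {ffun 'I_s -> I} => outputs b r [ffun l => phi (iota l)]).
Proof.
apply: eq_bigr => r _; rewrite -sum_prod_emp mulr_sumr.
by apply: eq_bigr => w _; rewrite mulrA.
Qed.

Lemma coin_dist_ge0 r : 0 <= coin_dist T r.
Proof. by have /andP[/forallP + _] := fdistP (coin_dist T); apply. Qed.

Lemma sum_coin_dist : \sum_r coin_dist T r = 1.
Proof. by have /andP[_ /eqP] := fdistP (coin_dist T). Qed.

Lemma sum_coin_le (F G : coins T -> R) (a : R) :
  (forall r, F r <= G r + a) ->
  \sum_r coin_dist T r * F r <= \sum_r coin_dist T r * G r + a.
Proof.
move=> FG; rewrite -[X in _ + X]mul1r -sum_coin_dist mulr_suml -big_split/=.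
by apply: ler_sum => r _; rewrite -mulrDr ler_wpM2l// coin_dist_ge0.
Qed.

Lemma output_prob_compl (I : finType) (I0 : (0 < #|I|)%N) (phi : I -> cube n) :
  output_prob T (emp R I0 phi) true + output_prob T (emp R I0 phi) false = 1.
Proof.
rewrite !output_prob_emp -big_split/= -[RHS]sum_coin_dist.
apply: eq_bigr => r _; rewrite -mulrDr -meanD -[RHS]mulr1; congr (_ * _).
rewrite -[RHS](@mean_cst _ {ffun 'I_s -> I}) ?card_ffun ?expn_gt0 ?I0//.
by apply: eq_mean => iota; rewrite /outputs; case: decide; rewrite ?addr0 ?add0r.
Qed.

End Testers.

(** * The two comparisons of acceptance probabilities *)

Definition mxrows (K U : finType) (n : nat) (M : {ffun K * U -> bool})
  (tau : 'I_n -> U) (i : K) : cube n := [ffun j => M (i, tau j)].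

(** The words constant on each fibre of [tau]; taken over all [f], they carry the distribution that
    the sample bound needs rejected. *)
Definition all_rows (t n : nat) (tau : 'I_n -> 'I_t) (f : cube t) : cube n :=
  [ffun j => f (tau j)].

(** For fixed coins only the samples in [J] are inspected, at most [minn s q] of them. If they are
    drawn from distinct rows of a random [M], they are independent uniform [t]-bit strings. *)
Lemma output_prob_mxrows_sample (R : realType) (n s q k t u : nat)
    (T : tester R n s q) (k0 : (0 < #|'I_k|)%N) (t0 : (0 < #|{: cube t}|)%N)
    (tau : 'I_n -> 'I_t) :
  (minn s q <= u)%N ->
  mean (fun M => output_prob T (emp R k0 (mxrows M tau)) true) <=
  output_prob T (emp R t0 (all_rows tau)) true + (u * u.-1)%:R / k%:R.
Proof.
move=> le_u; under eq_mean => M do rewrite output_prob_emp.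
rewrite mean_sum; under eq_bigr => r _ do rewrite meanZ.
rewrite output_prob_emp; apply: sum_coin_le => r.
rewrite exchange_mean.
(* Sample [l] is row [iota l] of [M], so the samples form the table [M] read through
   [kappa iota]. *)
pose kappa (iota : {ffun 'I_s -> 'I_k}) (a : 'I_s * 'I_t) := (iota a.1, a.2).
pose J := [set p.1 | p in queries r].
pose Phi (X : {ffun 'I_s * 'I_t -> bool}) :=
  outputs true r [ffun l => mxrows X tau l].
have Phi01 X : 0 <= Phi X <= 1.
  by rewrite /Phi /outputs; case: (_ == _); rewrite lexx ler01.
have PhiS (X Y : {ffun 'I_s * 'I_t -> bool}) :
    {in finset.setX J [set: 'I_t], X =1 Y} -> Phi X = Phi Y.
  move=> XY; apply: outputs_local => p pQ; rewrite !ffunE XY//.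
  by rewrite !inE andbT; apply: (imset_f fst).
have K0 : (0 < #|{ffun 'I_s -> 'I_k}|)%N by rewrite card_ffun expn_gt0 k0.
have := mean_ecomp_le kappa K0 Phi01 PhiS.
have -> : mean (fun iota => mean (fun M => Phi (ecomp M (kappa iota)))) =
  mean (fun iota : {ffun 'I_s -> 'I_k} =>
    mean (fun M => outputs true r [ffun l => mxrows M tau (iota l)])).
  apply: eq_mean => iota; apply: eq_mean => M; congr outputs.
  by apply/ffunP => l; rewrite !ffunE; apply/ffunP => j; rewrite !ffunE.
move=> /le_trans; apply; apply: lerD.
  (* A random [s] by [t] table is the same as [s] independent uniform [t]-bit strings. *)
  pose h (F : {ffun 'I_s -> cube t}) : {ffun 'I_s * 'I_t -> bool} :=
    [ffun a => F a.1 a.2].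
  rewrite (reindex_mean (h := h)); last first.
    pose g (X : {ffun 'I_s * 'I_t -> bool}) : {ffun 'I_s -> cube t} :=
      [ffun l => [ffun b => X (l, b)]].
    exists g => X.
      by apply/ffunP => l; apply/ffunP => b; rewrite !ffunE.
    by apply/ffunP => -[l b]; rewrite !ffunE.
  rewrite le_eqVlt; apply/orP; left; apply/eqP/eq_mean => F /=; congr outputs.
  by apply/ffunP => l; rewrite !ffunE; apply/ffunP => j; rewrite !ffunE.
apply: le_trans (le_trans (birthday R J k0) _).
  (* [kappa] keeps the column, so its collisions come from collisions of [iota] on [J]. *)
  apply: le_mean => iota; rewrite ler_nat.
  case: (boolP [forall _ in _, _]) => // ninj.
  case: (boolP [forall _ in _, _]) => // /forall_inP injJ; case/negP: ninj.
  apply/forall_inP => -[l b]; rewrite !inE andbT => lJ; apply/forall_inP => -[l' b'].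
  rewrite !inE andbT => l'J; apply/implyP => /= /eqP[E ->].
  move/forall_inP/(_ _ l'J): (injJ _ lJ).
  by rewrite /= in E *; rewrite E eqxx => /eqP ->.
rewrite card_ord ler_wpM2r ?invr_ge0// ler_nat.
have JU : (#|J| <= u)%N.
  apply: leq_trans le_u; rewrite leq_min; apply/andP; split.
    by rewrite -[leqRHS]card_ord max_card.
  exact: leq_trans (leq_imset_card _ _) (queries_le r).
by apply: leq_mul; lia.
Qed.

(** Coins and drawn rows [iota] are fixed first. At most [q] columns are then inspected, and if
    [tau] is injective on them, their entries are distributed as in an unrestricted random
    matrix. *)
Lemma output_prob_mxrows_query (R : realType) (n s q k t : nat)
    (T : tester R n s q) (k0 : (0 < #|'I_k|)%N) (t0 : (0 < #|'I_t|)%N) :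
  mean (fun tau : {ffun 'I_n -> 'I_t} =>
    mean (fun M => output_prob T (emp R k0 (mxrows M tau)) true)) <=
  mean (fun X => output_prob T (emp R k0 (mxrows X (@id 'I_n))) true)
  + (q * q.-1)%:R / t%:R.
Proof.
have -> : mean (fun X => output_prob T (emp R k0 (mxrows X (@id 'I_n))) true) =
  \sum_r coin_dist T r * mean (fun iota : {ffun 'I_s -> 'I_k} =>
    mean (fun X => outputs true r [ffun l => mxrows X id (iota l)])).
  under eq_mean => X do rewrite output_prob_emp.
  rewrite mean_sum; apply: eq_bigr => r _; by rewrite meanZ exchange_mean.
under eq_mean => tau.
  under eq_mean => M do rewrite output_prob_emp.
  rewrite mean_sum; under eq_bigr => r _ do rewrite meanZ exchange_mean.
  over.
rewrite mean_sum; under eq_bigr => r _ do rewrite meanZ exchange_mean.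
apply: sum_coin_le => r.
have K0 : (0 < #|{ffun 'I_s -> 'I_k}|)%N by rewrite card_ffun expn_gt0 k0.
rewrite -[X in _ + X](mean_cst _ K0) -meanD; apply: le_mean => iota.
pose kappa (tau : {ffun 'I_n -> 'I_t}) (a : 'I_k * 'I_n) := (a.1, tau a.2).
pose J := [set p.2 | p in queries r].
pose Phi (X : {ffun 'I_k * 'I_n -> bool}) :=
  outputs true r [ffun l => mxrows X id (iota l)].
have Phi01 X : 0 <= Phi X <= 1.
  by rewrite /Phi /outputs; case: (_ == _); rewrite lexx ler01.
have PhiS (X Y : {ffun 'I_k * 'I_n -> bool}) :
    {in finset.setX [set: 'I_k] J, X =1 Y} -> Phi X = Phi Y.
  move=> XY; apply: outputs_local => p pQ; rewrite !ffunE XY//.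
  by rewrite !inE; apply: (imset_f snd).
have L0 : (0 < #|{ffun 'I_n -> 'I_t}|)%N by rewrite card_ffun expn_gt0 t0.
have := mean_ecomp_le kappa L0 Phi01 PhiS.
have -> : mean (fun tau => mean (fun M => Phi (ecomp M (kappa tau)))) =
  mean (fun tau : {ffun 'I_n -> 'I_t} =>
    mean (fun M => outputs true r [ffun l => mxrows M tau (iota l)])).
  apply: eq_mean => tau; apply: eq_mean => M; congr outputs.
  by apply/ffunP => l; rewrite !ffunE; apply/ffunP => j; rewrite !ffunE.
move=> /le_trans; apply; rewrite lerD2l.
apply: le_trans (le_trans (birthday R J t0) _).
  apply: le_mean => tau; rewrite ler_nat.
  case: (boolP [forall _ in _, _]) => // ninj.
  case: (boolP [forall _ in _, _]) => // /forall_inP injJ; case/negP: ninj.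
  apply/forall_inP => -[i j]; rewrite !inE => /= jJ; apply/forall_inP => -[i' j'].
  rewrite !inE => /= j'J; apply/implyP => /= /eqP[-> E].
  move/forall_inP/(_ _ j'J): (injJ _ jJ).
  by rewrite /= in E *; rewrite E eqxx => /eqP ->.
rewrite card_ord ler_wpM2r ?invr_ge0// ler_nat.
have JU : (#|J| <= q)%N.
  exact: leq_trans (leq_imset_card _ _) (queries_le r).
by apply: leq_mul; lia.
Qed.

(** * Hamming distances, couplings and the Earth Mover Distance *)

Definition dist (A : finType) (f g : {ffun A -> bool}) : nat :=
  (\sum_a (f a != g a))%N.

Lemma hammingE (R : realType) (n : nat) (x y : cube n) :
  hamming R x y = (dist x y)%:R / n%:R.
Proof.
by rewrite /hamming /dist -sum1dep_card big_mkcond /=; congr (_%:R / _).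
Qed.

(** A random [f] differs from [g] in each coordinate independently with probability 1/2, so the
    moment factorizes. *)
Lemma mean_exp_dist (R : realType) (A : finType) (x : R) (g : {ffun A -> bool}) :
  mean (fun f => x ^+ dist f g) = ((1 + x) / 2) ^+ #|A|.
Proof.
rewrite /mean card_ffun card_bool natrX exprMn exprVn; congr (_ / _).
under eq_bigr => f _ do rewrite expr_sum.
rewrite -(bigA_distr_bigA (fun a b => x ^+ (b != g a))) /=.
rewrite (eq_bigr (fun=> 1 + x)) ?prodr_const// => a _.
by rewrite big_bool; case: (g a); rewrite /= expr0 expr1// addrC.
Qed.

Lemma ler_sum_inj (R : realType) (A B : finType) (e : A -> B) (F : B -> R) :
  injective e -> (forall b, 0 <= F b) -> \sum_a F (e a) <= \sum_b F b.
Proof.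
move=> e_inj F0; rewrite -(big_imset _ (fun a b _ _ => @e_inj a b)) /=.
rewrite [leRHS](bigID (mem [set e x | x in xpredT]%SET))/= lerDl.
exact: sumr_ge0.
Qed.

Section Emd.
Variables (R : realType) (n : nat).
Implicit Types D : fdist R (cube n).

Lemma prod_fdist_subproof D1 D2 :
  let f := [ffun p => D1 p.1 * D2 p.2] : {ffun cube n * cube n -> R} in
  [forall x, 0 <= f x] && (\sum_x f x == 1).
Proof.
have /andP[/forallP D10 /eqP D11] := fdistP D1.
have /andP[/forallP D20 /eqP D21] := fdistP D2.
apply/andP; split; first by apply/forallP => p; rewrite ffunE mulr_ge0.
under eq_bigr => p _ do rewrite ffunE.
rewrite -(pair_bigA _ (fun x y => D1 x * D2 y))/=.
under eq_bigr => x _ do rewrite -mulr_sumr D21 mulr1.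
exact/eqP.
Qed.

(** Provides a coupling, so that the infimum in [emd] is over a nonempty set. *)
Lemma coupling_prod D1 D2 : coupling D1 D2 (FDist (prod_fdist_subproof D1 D2)).
Proof.
have /andP[_ /eqP D11] := fdistP D1.
have /andP[_ /eqP D21] := fdistP D2.
split=> [x|y] /=.
  by under eq_bigr => y _ do rewrite ffunE /=; rewrite -mulr_sumr D21 mulr1.
by under eq_bigr => x _ do rewrite ffunE /=; rewrite -mulr_suml D11 mul1r.
Qed.

Lemma fdist_ge0 (T : finType) (D : fdist R T) x : 0 <= D x.
Proof. by have /andP[/forallP + _] := fdistP D; apply. Qed.

Lemma emd_ge D1 D2 (a : R) :
  (forall g, coupling D1 D2 g -> a <= transport_cost g) -> a <= emd D1 D2.
Proof.
move=> ag; apply: lb_le_inf; last by move=> _ [g /ag ? <-].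
exists (transport_cost (FDist (prod_fdist_subproof D1 D2))).
by eexists; first exact: coupling_prod.
Qed.

Lemma emd_lt D1 D2 (a : R) : emd D1 D2 < a ->
  exists2 g, coupling D1 D2 g & transport_cost g < a.
Proof.
move=> /inf_lt [|_ [g cg <-] lt_ga]; last by exists g.
exists (transport_cost (FDist (prod_fdist_subproof D1 D2))).
by eexists; first exact: coupling_prod.
Qed.

(** The coupling charges only pairs whose second point is some [psi j], so [h] there is one term of
    the sum over [j]; the first marginal gives the mean over [i]. *)
Lemma coupling_emp_le (I J : finType) (I0 : (0 < #|I|)%N) (J0 : (0 < #|J|)%N)
    (phi : I -> cube n) (psi : J -> cube n) g (h : cube n -> cube n -> R) :
  coupling (emp R I0 phi) (emp R J0 psi) g ->
  (forall x y, 0 <= h x y) ->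
  \sum_p g p * h p.1 p.2 <= mean (fun i => \sum_j h (phi i) (psi j)).
Proof.
move=> [g1 g2] h0.
rewrite -(sum_emp I0 phi (fun x => \sum_j h x (psi j))).
under [leRHS]eq_bigr => x _ do rewrite -g1 mulr_suml.
rewrite (pair_bigA _ (fun x y => g (x, y) * \sum_j h x (psi j)))/=.
apply: ler_sum => -[x y] _ /=.
have [->|gxy] := eqVneq (g (x, y)) 0; first by rewrite !mul0r.
apply: ler_wpM2l; first exact: fdist_ge0.
have [j ->] : exists j, y = psi j.
  apply: (@emp_neq0 R _ _ J0); rewrite -g2 gt_eqF// (bigD1 x)//=.
  by rewrite ltr_pwDl ?lt_def ?gxy ?fdist_ge0// sumr_ge0// => ? _; apply: fdist_ge0.
by rewrite (bigD1 j)//= lerDl sumr_ge0.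
Qed.

End Emd.

(** * Distance from the uniform block strings to small supports *)

Definition modn_ord (n t : nat) (t0 : (0 < t)%N) (j : 'I_n) : 'I_t :=
  Ordinal (ltn_pmod j t0).

Lemma block_subproof (n t : nat) (p : 'I_(n %/ t)) (b : 'I_t) :
  (p * t + b < n)%N.
Proof.
apply: leq_trans (leq_trunc_div n t).
apply: (@leq_trans (p.+1 * t)); first by rewrite mulSn addnC ltn_add2r.
by rewrite leq_mul2r ltn_ord orbT.
Qed.

(** The [p]-th run of [t] consecutive indices; the last [n %% t] indices lie in no block. *)
Definition block (n t : nat) (p : 'I_(n %/ t)) (b : 'I_t) : 'I_n :=
  Ordinal (block_subproof p b).

Lemma modn_ord_block (n t : nat) (t0 : (0 < t)%N) (p : 'I_(n %/ t)) (b : 'I_t) :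
  modn_ord t0 (block p b) = b.
Proof. by apply: val_inj; rewrite /= modnMDl modn_small. Qed.

Lemma block_inj (n t : nat) :
  injective (fun a : 'I_(n %/ t) * 'I_t => block a.1 a.2).
Proof.
move=> [p b] [p' b'] /(congr1 val) /= E.
have t0 : (0 < t)%N by exact: leq_ltn_trans (leq0n b) (ltn_ord b).
have eqb : b = b'.
  apply: val_inj; move: (congr1 (modn^~ t) E).
  by rewrite /= !modnMDl !modn_small.
congr (_, _) => //; apply: val_inj; apply/eqP; move/eqP: E.
by rewrite eqb eqn_add2r eqn_pmul2r.
Qed.

(* The bound [a - B * x ^+ m <= m] turns the expected distance from a random
   point to the [k] points of a support into the exponential moment
   [mean_exp_dist]. *)
Lemma emd_all_rows_ge (R : realType) (n k t : nat) (k0 : (0 < #|'I_k|)%N)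
    (t0 : (0 < t)%N) (c0 : (0 < #|{: cube t}|)%N) (phi : 'I_k -> cube n)
    (a B x : R) :
  (t <= n)%N -> 0 <= a -> 0 <= B -> 0 <= x ->
  (forall m : nat, a - B * x ^+ m <= m%:R) ->
  B * (k%:R * ((1 + x) / 2) ^+ t) <= a / 2 ->
  a / (4 * t%:R) <= emd (emp R c0 (all_rows (modn_ord t0))) (emp R k0 phi).
Proof.
move=> le_tn a0 B0 x0 aBx Bka; apply: emd_ge => g cg.
set m := (n %/ t)%N.
pose res (p : 'I_m) (y : cube n) : cube t := [ffun b => y (block p b)].
have n0 : 0 < n%:R :> R by rewrite ltr0n (leq_trans t0).
have T0 : 0 < t%:R :> R by rewrite ltr0n.
have distE (y z : cube n) :
    \sum_(p < m) (dist (res p y) (res p z))%:R <= (dist y z)%:R :> R.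
  rewrite /dist natr_sum.
  have -> : \sum_(p < m) (\sum_b (res p y b != res p z b))%:R =
      \sum_(p < m) \sum_b (y (block p b) != z (block p b))%:R :> R.
    apply: eq_bigr => p _; rewrite natr_sum.
    by apply: eq_bigr => b _; rewrite !ffunE.
  rewrite pair_bigA/=; apply: (ler_sum_inj (F := fun j => (y j != z j)%:R)) => //.
  exact: block_inj.
(* Restricted to any block, the first marginal is uniform on [t]-bit strings, while the second has
   at most [k] support points. *)
have gE p : a / 2 <= \sum_q g q * (dist (res p q.1) (res p q.2))%:R.
  have /andP[_ /eqP g1] := fdistP g.
  have /= := coupling_emp_le (h := fun y z => x ^+ dist (res p y) (res p z)) cg
    (fun _ _ => exprn_ge0 _ x0).
  rewrite (_ : mean _ = k%:R * ((1 + x) / 2) ^+ t); last first.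
    rewrite mean_sum (eq_bigr (fun=> ((1 + x) / 2) ^+ t)) => [|l _].
      by rewrite sumr_const card_ord mulr_natl.
    rewrite -[in RHS](card_ord t) -(mean_exp_dist x (res p (phi l))).
    apply: eq_mean => f; congr (_ ^+ dist _ _).
    by apply/ffunP => b; rewrite !ffunE modn_ord_block.
  move=> /(ler_wpM2l B0)/le_trans/(_ Bka).
  rewrite mulr_sumr => le_a.
  apply: (@le_trans _ _ (\sum_q g q * (a - B * x ^+ dist (res p q.1) (res p q.2)))).
    under eq_bigr => q _ do rewrite mulrBr mulrCA.
    by rewrite sumrB -mulr_suml g1; move: le_a; lra.
  by apply: ler_sum => q _; rewrite ler_wpM2l ?fdist_ge0.
have : m%:R * (a / 2) <= n%:R * transport_cost g.
  rewrite -{1}(card_ord m) mulr_natl -sumr_const.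
  apply: (le_trans (ler_sum _ (fun p _ => gE p))).
  rewrite exchange_big mulr_sumr; apply: ler_sum => q _ /=.
  rewrite hammingE mulrCA [n%:R * _]mulrC divfK ?gt_eqF// -mulr_sumr.
  by rewrite ler_wpM2l ?fdist_ge0.
(* As [t <= n], the full blocks cover at least half of the coordinates; together with the half in
   [a / 2] this gives the factor 4. *)
have le_n : n%:R <= 2 * (t%:R * m%:R) :> R.
  rewrite -!natrM ler_nat; have := ltn_ceil n t0; rewrite -/m.
  have : (0 < m)%N by rewrite divn_gt0.
  nia.
move=> le_mg; rewrite ler_pdivrMr ?mulr_gt0//.
rewrite -(ler_pM2l n0) mulrA.
have := ler_wpM2l (ltW T0) le_mg.
have := ler_wpM2r a0 le_n.
nra.
Qed.

(** * From a cheap coupling to a nearby matrix with few column types *)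

Definition col_types (K U : finType) (n : nat) (tau : 'I_n -> U) (a : K * 'I_n) :=
  (a.1, tau a.2).

(* Rounding the conditional probabilities of the coupling to the nearest bit
   costs a factor 2. *)
Lemma coupling_mxrows_dist (R : realType) (n k t : nat) (k0 : (0 < #|'I_k|)%N)
    (X : {ffun 'I_k * 'I_n -> bool}) (M : {ffun 'I_k * 'I_t -> bool})
    (tau : 'I_n -> 'I_t) g :
  (0 < n)%N ->
  coupling (emp R k0 (mxrows X id)) (emp R k0 (mxrows M tau)) g ->
  exists Z : {ffun 'I_k * 'I_t -> bool},
    (dist X (ecomp Z (col_types tau)))%:R <=
    2 * (k%:R * (n%:R * transport_cost g)) :> R.
Proof.
move=> n0 [g1 g2].
have k1 : (0 < k)%N by rewrite -(card_ord k).
(* Some row equal to [y]; the default occurs only for points of mass 0. *)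
pose lab (y : cube n) : 'I_k := odflt (Ordinal k1) [pick l | y == mxrows M tau l].
pose bit y b := M (lab y, b).
have bitE x y j : g (x, y) != 0 -> y j = bit y (tau j).
  move=> gxy; rewrite /bit /lab; case: pickP => [l /eqP {1}->|nol] /=.
    by rewrite ffunE.
  have [l /eqP] : exists l, y = mxrows M tau l; last by rewrite nol.
  apply: (@emp_neq0 R _ _ k0); rewrite -g2 gt_eqF// (bigD1 x)//=.
  by rewrite ltr_pwDl ?lt_def ?gxy ?fdist_ge0// sumr_ge0// => ? _; apply: fdist_ge0.
set D := emp R k0 (mxrows X id) in g1 *.
(* The majority value, given [x], of the type-[b] bit of [y]; a tie gives [true]. *)
pose z x b := D x / 2 <= \sum_y g (x, y) * (bit y b)%:R.
(* If [x j] disagrees with the majority, at least half of the mass at [x] pays for coordinate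
   [j]. *)
have zE x j : D x * (x j != z x (tau j))%:R <= 2 * \sum_y g (x, y) * (x j != y j)%:R.
  have -> : \sum_y g (x, y) * (x j != y j)%:R =
            \sum_y g (x, y) * (x j != bit y (tau j))%:R.
    apply: eq_bigr => y _.
    have [->|gxy] := eqVneq (g (x, y)) 0; first by rewrite !mul0r.
    by rewrite -(bitE x).
  rewrite /z; case: (x j).
    have -> : \sum_y g (x, y) * (true != bit y (tau j))%:R =
        D x - \sum_y g (x, y) * (bit y (tau j))%:R.
      rewrite -g1 -sumrB; apply: eq_bigr => y _.
      by case: (bit _ _) => /=; rewrite ?mulr1 ?mulr0 ?subrr ?subr0.
    case: (leP (D x / 2)) => /=; have := fdist_ge0 D x.
      have : \sum_y g (x, y) * (bit y (tau j))%:R <= D x.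
        rewrite -g1; apply: ler_sum => y _; case: (bit _ _); rewrite ?mulr1 ?mulr0//.
        exact: fdist_ge0.
      lra.
    lra.
  have -> : \sum_y g (x, y) * (false != bit y (tau j))%:R =
            \sum_y g (x, y) * (bit y (tau j))%:R.
    by apply: eq_bigr => y _; case: (bit _ _).
  case: (leP (D x / 2)) => /=; first lra.
  rewrite mulr0 => _; rewrite mulr_ge0// sumr_ge0// => y _.
  by rewrite mulr_ge0 ?fdist_ge0.
exists [ffun a => z (mxrows X id a.1) a.2].
pose F (x : cube n) : R := \sum_j (x j != z x (tau j))%:R.
have -> : (dist X (ecomp [ffun a => z (mxrows X id a.1) a.2] (col_types tau)))%:R =
    k%:R * \sum_x D x * F x.
  rewrite sum_emp /mean /= card_ord mulrC divfK ?gt_eqF ?ltr0n//.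
  rewrite /dist natr_sum /F pair_bigA/=; apply: eq_bigr => -[i j] _.
  by rewrite !ffunE.
rewrite mulrCA; apply: ler_wpM2l => //.
have -> : n%:R * transport_cost g = \sum_x \sum_j \sum_y g (x, y) * (x j != y j)%:R.
  have -> : transport_cost g = \sum_x \sum_y g (x, y) * hamming R x y.
    by rewrite pair_bigA; apply: eq_bigr => -[].
  rewrite mulr_sumr; apply: eq_bigr => x _; rewrite mulr_sumr exchange_big/=.
  apply: eq_bigr => y _; rewrite hammingE mulrCA [n%:R * _]mulrC divfK; last first.
    by rewrite pnatr_eq0 -lt0n.
  by rewrite /dist natr_sum mulr_sumr.
rewrite mulr_sumr; apply: ler_sum => x _; rewrite /F !mulr_sumr.
by apply: ler_sum => j _.
Qed.

(** * The property and its structural requirements *)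

Definition few_types (R : realType) (n k t : nat) (k0 : (0 < #|'I_k|)%N) :
  set (fdist R (cube n)) :=
  [set D | exists (M : {ffun 'I_k * 'I_t -> bool}) (tau : {ffun 'I_n -> 'I_t}),
    D = emp R k0 (mxrows M tau)]%classic.

Arguments few_types {R n} k t k0 D : rename.

Section FewTypes.
Variables (R : realType) (n k t : nat) (k0 : (0 < #|'I_k|)%N).

(** There are finitely many pairs [(M, tau)], and finite sets are closed in a Hausdorff space. *)
Lemma few_types_closed : closed_property (@few_types R n k t k0).
Proof.
have ptws_acc : accessible_space {ptws cube n -> R}.
  apply: hausdorff_accessible; apply: hausdorff_product => _.
  exact: norm_hausdorff.
have [finite_closed _] := @accessible_finite_set_closed {ptws cube n -> R}.
apply: finite_closed => //.
pose F (p : {ffun 'I_k * 'I_t -> bool} * {ffun 'I_n -> 'I_t}) :=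
  emp R k0 (mxrows p.1 p.2).
apply: finite_image; apply: (@sub_finite_set _ _ (F @` setT)%classic).
  by move=> _ [M [tau ->]]; exists (M, tau).
exact/finite_image/finite_finset.
Qed.

Lemma perm_dist_emp (I : finType) (I0 : (0 < #|I|)%N) (phi : I -> cube n) sigma :
  perm_dist (emp R I0 phi) sigma = emp R I0 (perm_cube sigma \o phi).
Proof.
apply: val_inj; apply/ffunP => x; rewrite !ffunE; apply: eq_mean => i /=.
by rewrite -(inj_eq (can_inj (perm_cubeK sigma))) perm_cubeVK.
Qed.

Lemma perm_distK sigma : cancel (fun D : fdist R (cube n) => perm_dist D sigma)
  (fun D => perm_dist D sigma^-1%g).
Proof.
by move=> D; apply: val_inj; apply/ffunP => x; rewrite !ffunE invgK perm_cubeK.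
Qed.

Lemma few_types_perm_dist (D : fdist R (cube n)) sigma :
  @few_types R n k t k0 D -> few_types k t k0 (perm_dist D sigma).
Proof.
move=> [M [tau ->]]; exists M, [ffun j => tau (sigma j)].
rewrite perm_dist_emp; congr (emp R k0 _); apply/funext => i.
by apply/ffunP => j; rewrite !ffunE.
Qed.

Lemma few_types_index_invariant : index_invariant (@few_types R n k t k0).
Proof.
move=> sigma D; split; first exact: few_types_perm_dist.
by move=> /(few_types_perm_dist sigma^-1%g); rewrite perm_distK.
Qed.

End FewTypes.

(** Shattering [m] indices takes [2 ^ m] distinct projections. *)
Lemma vc_dim_card (n d : nat) (V : {set cube n}) :
  (#|V| <= 2 ^ d)%N -> (vc_dim V <= d)%N.
Proof.
move=> Vd; apply/bigmax_leqP => m /existsP[u /eqP shV].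
rewrite -(leq_exp2l (m := 2)) //; apply: leq_trans Vd.
rewrite -[X in (2 ^ X)%N]card_ord -card_bool -card_ffun -cardsT -shV.
exact: leq_imset_card.
Qed.

Lemma few_types_vc_dim (R : realType) (n d t : nat) (k0 : (0 < #|'I_(2 ^ d)|)%N) :
  property_vc_dim_le (@few_types R n (2 ^ d) t k0) d.
Proof.
move=> D [M [tau ->]]; apply: vc_dim_card.
apply: (@leq_trans #|[set mxrows M tau i | i in 'I_(2 ^ d)]|); last first.
  by rewrite (leq_trans (leq_imset_card _ _))// card_ord.
apply/subset_leq_card/fintype.subsetP => x; rewrite inE => /emp_neq0[i ->].
exact: imset_f.
Qed.

(** * Sample and query bounds for general parameters *)

Lemma sample_bound (R : realType) (n k t s q : nat) (k0 : (0 < #|'I_k|)%N)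
    (t0 : (0 < t)%N) (c0 : (0 < #|{: cube t}|)%N) (eps : R) (T : tester R n s q) :
  (forall D : fdist R (cube n), few_types k t k0 D ->
    eps < emd (emp R c0 (all_rows (modn_ord t0))) D) ->
  is_tester eps (few_types k t k0) T ->
  (k <= 3 * (minn s q * (minn s q).-1))%N.
Proof.
move=> far_rows [acc rej].
have le_mean23 : 2 / 3 <= mean (fun M =>
    output_prob T (emp R k0 (mxrows M (modn_ord t0))) true).
  apply: le_cst_mean (card_ffun_bool_gt0 _) _ => M; apply: acc.
  exists M, [ffun j => modn_ord t0 j]; congr (emp R k0 _); apply/funext => i.
  by apply/ffunP => j; rewrite !ffunE.
have := output_prob_mxrows_sample T k0 c0 (modn_ord t0) (leqnn _).
have := rej _ far_rows; have := output_prob_compl T c0 (all_rows (modn_ord t0)).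
set v := (_ * _)%N => E1 E2 E3.
have kgt0 : 0 < k%:R :> R by rewrite ltr0n -(card_ord k).
(* Mean acceptance is at least 2/3 on the property and at most 1/3 on the far distribution. *)
have : 1 / 3 <= v%:R / k%:R :> R by lra.
by rewrite ler_pdivlMr// -(ler_nat R) natrM; lra.
Qed.

(** Numerically [(3 / 4) ^ 32] is about [2 ^ -13.3]; the exponent 12 suffices for both union
    bounds. *)
Lemma pow32_3_4 (R : realType) (m : nat) :
  ((3 / 4) ^+ 32) ^+ m <= (2^-1) ^+ (12 * m) :> R.
Proof.
by rewrite exprM lerXn2r ?nnegrE ?exprn_ge0//; lra.
Qed.

Lemma pow2_cancel (R : realType) (a b c : nat) :
  (a + c <= b)%N -> 2 ^+ a * (2^-1) ^+ b <= (2^-1) ^+ c :> R.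
Proof.
move=> le_ab; rewrite -(subnKC (leq_trans (leq_addr c a) le_ab)) exprD mulrA.
rewrite -exprMn divff ?expr1n ?mul1r ?pnatr_eq0//.
by apply: ler_wiXn2l; rewrite ?invr_ge0//; [lra | lia].
Qed.

Lemma query_bound (R : realType) (n k t c s q : nat) (k0 : (0 < #|'I_k|)%N)
    (eps : R) (T : tester R n s q) :
  k = (32 * c)%N -> t = (2 ^ (4 * c))%N -> (0 < c)%N -> (t * 8 <= n)%N ->
  0 < eps -> eps <= 256^-1 ->
  is_tester eps (few_types k t k0) T ->
  (t <= 6 * (q * q.-1))%N.
Proof.
move=> kE tE c0 le_tn eps0 le_eps [acc rej].
have tgt0 : (0 < t)%N by rewrite tE expn_gt0.
have ngt0 : (0 < n)%N by apply: leq_trans le_tn; rewrite muln_gt0 tgt0.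
have t0 : (0 < #|'I_t|)%N by rewrite card_ord.
have tau0 : (0 < #|{ffun 'I_n -> 'I_t}|)%N by rewrite card_ffun expn_gt0 t0.
have yes : 2 / 3 <= mean (fun tau : {ffun 'I_n -> 'I_t} =>
    mean (fun M => output_prob T (emp R k0 (mxrows M tau)) true)).
  apply: le_cst_mean tau0 _ => tau.
  apply: le_cst_mean (card_ffun_bool_gt0 _) _ => M.
  by apply: acc; exists M, tau.
(* An exponential Markov bound: [W X] is at least 1 as soon as [X] is within [c * n] entries of some
   matrix with at most [t] column types. *)
pose W (X : {ffun 'I_k * 'I_n -> bool}) : R :=
  \sum_(tau : {ffun 'I_n -> 'I_t}) \sum_(Z : {ffun 'I_k * 'I_t -> bool})
    2 ^+ (c * n) * (2^-1) ^+ dist X (ecomp Z (col_types tau)).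
have W0 X : 0 <= W X.
  by do 2!apply: sumr_ge0 => ? _; rewrite mulr_ge0 ?exprn_ge0 ?invr_ge0.
have no X : output_prob T (emp R k0 (mxrows X id)) true <= 1 / 3 + W X.
  have := output_prob_compl T k0 (mxrows X id).
  have [/rej|/existsNP[D /not_implyP[[M [tau ->]]]]] :=
    pselect (far eps (few_types k t k0) (emp R k0 (mxrows X id))).
    by have := W0 X; lra.
  move=> /negP; rewrite -leNgt => le_emd.
  (* The infimum need not be attained, hence [2 * eps]. The rounded matrix then differs in at most
     [2 * k * n / 128 = c * n / 2] entries. *)
  have [|g cg lt_g] := @emd_lt _ _ _ _ (2 * eps) (le_lt_trans le_emd _); first lra.
  have [Z distZ] := coupling_mxrows_dist ngt0 cg.
  have le_dist : (dist X (ecomp Z (col_types tau)) <= c * n)%N.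
    rewrite -(ler_nat R); apply: (le_trans distZ); rewrite kE !natrM.
    have cn0 : 0 <= c%:R * n%:R :> R by rewrite mulr_ge0.
    have : (c%:R * n%:R) * transport_cost g <= (c%:R * n%:R) * 128^-1.
      by apply: ler_wpM2l => //; lra.
    lra.
  have : 1 <= W X.
    rewrite /W (bigD1 tau)//= (bigD1 Z)//= -addrA.
    apply: le_trans
      (_ : 1 <= 2 ^+ (c * n) * (2^-1) ^+ dist X (ecomp Z (col_types tau))) _.
      rewrite -[leLHS](expr1n _ (c * n)) -{1}(@divff _ (2 : R)) ?pnatr_eq0//.
      rewrite exprMn ler_wpM2l ?exprn_ge0//.
      by apply: ler_wiXn2l => //; rewrite ?invr_ge0//; lra.
    rewrite lerDl addr_ge0//; do ?[apply: sumr_ge0 => ? _];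
      by rewrite mulr_ge0 ?exprn_ge0 ?invr_ge0.
  have : 0 <= output_prob T (emp R k0 (mxrows X id)) false.
    rewrite output_prob_emp; apply: sumr_ge0 => r _.
    rewrite mulr_ge0 ?coin_dist_ge0// /mean mulr_ge0 ?invr_ge0//.
    by apply: sumr_ge0 => ? _; rewrite /outputs.
  lra.
(* There are [2 ^ (4 * c * n)] maps [tau] and [2 ^ (k * t)] matrices [Z], with [k * t <= 4 * c * n].
   The weights contribute [2 ^ (c * n)] and a moment of at most [2 ^ -(12 * c * n)], leaving
   [2 ^ -(3 * c * n)]. *)
have meanW : mean W <= 8^-1.
  pose v : R := 2 ^+ (c * n) * ((3 / 4) ^+ 32) ^+ (c * n).
  have v0 : 0 <= v by rewrite mulr_ge0// exprn_ge0// ?exprn_ge0//; lra.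
  have -> : mean W = (2 ^+ (4 * c * n) * 2 ^+ (k * t)) * v.
    rewrite mean_sum (eq_bigr (fun=> 2 ^+ (k * t) * v)) => [|tau _].
      rewrite sumr_const card_ffun !card_ord.
      by rewrite -[_ *+ (_ ^ _)]mulr_natl mulrA tE -expnM natrX.
    rewrite mean_sum (eq_bigr (fun=> v)) => [|Z _].
      rewrite sumr_const card_ffun card_bool card_prod !card_ord.
      by rewrite -[_ *+ (_ ^ _)]mulr_natl natrX.
    rewrite meanZ mean_exp_dist card_prod !card_ord /v -exprM mulnA -kE.
    by congr (_ * _ ^+ _); field.
  have := pow32_3_4 R (c * n).
  move=> /(ler_wpM2l (exprn_ge0 (c * n) (ler0n R 2))) le_v.
  apply: le_trans (ler_wpM2l _ le_v) _; first by rewrite mulr_ge0// exprn_ge0.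
  rewrite mulrA -!exprD; apply: le_trans (pow2_cancel _ (c := 3) _) _.
    by rewrite kE; nia.
  by rewrite !exprS expr0; lra.
have := output_prob_mxrows_query T k0 t0.
have : mean (fun X => output_prob T (emp R k0 (mxrows X (@id 'I_n))) true)
    <= 1 / 3 + mean W.
  rewrite -[1 / 3](mean_cst _ (card_ffun_bool_gt0 ('I_k * 'I_n)%type)) -meanD.
  exact: le_mean.
set v := (q * _)%N => E1 E2.
have Tgt0 : 0 < t%:R :> R by rewrite ltr0n.
(* The gap is at least [2 / 3 - 1 / 3 - 1 / 8 = 5 / 24]. *)
have : 1 / 6 <= v%:R / t%:R :> R by lra.
by rewrite ler_pdivlMr// -(ler_nat R) natrM; lra.
Qed.

(** * Choice of the number of column types and final bounds *)

(* Random [t]-bit strings must not be covered by [2 ^ d] rows.  For small [d]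
   this excludes [2 ^ 2 ^ (d - 3)], and the query bound is then at most 2. *)
Definition num_types (d : nat) : nat :=
  if (d < 6)%N then d.+1 else (2 ^ (2 ^ (d - 3)))%N.

Lemma num_types_gt0 d : (0 < num_types d)%N.
Proof. by rewrite /num_types; case: ifP; rewrite ?expn_gt0. Qed.

Lemma num_types_bound d n : (2 ^ (2 ^ d) <= n)%N -> (num_types d <= n)%N.
Proof.
apply: leq_trans; rewrite /num_types; case: ifP => _.
  exact: leq_trans (ltn_expl d (ltnSn 1)) (ltnW (ltn_expl _ (ltnSn 1))).
by rewrite leq_exp2l// leq_exp2l// leq_subr.
Qed.

(** For [m < r] the factor [2 ^ (r - m)] makes the left side nonpositive; for [m >= r] already
    [r <= m]. *)
Lemma expr_half_bound (R : realType) (r m : nat) :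
  r%:R - r%:R * 2 ^+ r * (2^-1) ^+ m <= m%:R :> R.
Proof.
have [le_rm|lt_mr] := leqP r m.
  apply: (@le_trans _ _ r%:R); last by rewrite ler_nat.
  by rewrite gerBl !mulr_ge0 ?exprn_ge0 ?invr_ge0.
apply: (@le_trans _ _ 0) => //; rewrite subr_le0 -mulrA ler_peMr//.
rewrite -(subnKC (ltnW lt_mr)) exprD mulrAC -exprMn divff ?pnatr_eq0//.
by rewrite expr1n mul1r exprn_ege1// ler1n.
Qed.

(** The second bound is [r + d + 1 <= 12 * r], which makes [2 ^ r * 2 ^ d * 2 ^ -(12 * r)] at most
    1/2. *)
Lemma num_types_large d : (6 <= d)%N ->
  exists2 r, num_types d = (32 * r)%N & (d.+1 <= 11 * r)%N.
Proof.
move=> d6; have [m ->] : exists m, d = (m + 6)%N by exists (d - 6)%N; rewrite subnK.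
rewrite /num_types ltnNge leq_addl/= -addnBA// addnC expnD.
have h : (m.+1 <= 2 ^ m)%N by exact: ltn_expl.
exists (2 ^ (8 * 2 ^ m - 5))%N.
  by rewrite -(expnD 2 5) subnKC//; lia.
have : (8 * 2 ^ m - 5 < 2 ^ (8 * 2 ^ m - 5))%N by exact: ltn_expl.
lia.
Qed.

Lemma emd_all_rows_num_types (R : realType) (n d : nat)
    (k0 : (0 < #|'I_(2 ^ d)|)%N) (c0 : (0 < #|{: cube (num_types d)}|)%N)
    (phi : 'I_(2 ^ d) -> cube n) :
  (2 ^ (2 ^ d) <= n)%N ->
  128^-1 <= emd (emp R c0 (all_rows (modn_ord (num_types_gt0 d)))) (emp R k0 phi).
Proof.
move=> /num_types_bound le_tn; have [d6|d6] := ltnP d 6.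
  (* With [x = 0] and [0 ^ 0 = 1] the moment counts exact hits: [2 ^ d] rows cover at most half of
     the strings of [d + 1] bits. *)
  have := emd_all_rows_ge k0 (num_types_gt0 d) c0 phi le_tn
    (a := 1) (B := 1) (x := 0).
  have tE : num_types d = d.+1 by rewrite /num_types d6.
  have bound_ge : 128^-1 <= 1 / (4 * (num_types d)%:R) :> R.
    rewrite tE ler_pdivlMr ?mulr_gt0 ?ltr0n//.
    have : d.+1%:R <= 6 :> R by rewrite ler_nat.
    lra.
  move=> H; apply: (le_trans bound_ge); apply: H => // [m|].
    case: m => [|m]; first by rewrite expr0 mulr1 subrr.
    by rewrite exprS mul0r mulr0 subr0 ler1n.
  rewrite mul1r addr0 tE natrX exprS mulrCA -exprMn mul1r divff ?pnatr_eq0//.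
  by rewrite expr1n; lra.
have [r tE le_dr] := num_types_large d6.
have r0 : (0 < r)%N by lia.
have r0R : 0 < r%:R :> R by rewrite ltr0n.
(* As [num_types d = 32 * r], taking [a = r] yields exactly [r / (4 * 32 * r) = 1 / 128]. *)
have := emd_all_rows_ge k0 (num_types_gt0 d) c0 phi le_tn
  (a := r%:R) (B := r%:R * 2 ^+ r) (x := 2^-1).
have bound_ge : 128^-1 <= r%:R / (4 * (num_types d)%:R) :> R.
  by rewrite tE natrM ler_pdivlMr ?mulr_gt0 ?ltr0n//; lra.
move=> H; apply: (le_trans bound_ge); apply: H;
  rewrite ?invr_ge0 ?mulr_ge0 ?exprn_ge0//.
  exact: expr_half_bound.
rewrite -mulrA ler_wpM2l// tE exprM natrX mulrA -exprD.
rewrite (_ : (1 + 2^-1) / 2 = 3 / 4 :> R); last by field.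
apply: le_trans (ler_wpM2l _ (pow32_3_4 R r)) _; first exact: exprn_ge0.
by apply: le_trans (pow2_cancel _ (c := 1) _) _; [lia | rewrite expr1].
Qed.

Lemma few_types_sample_bound (R : realType) (n d s q : nat)
    (k0 : (0 < #|'I_(2 ^ d)|)%N) (eps : R) (T : tester R n s q) :
  (2 ^ (2 ^ d) <= n)%N -> 0 < eps -> eps <= 256^-1 ->
  is_tester eps (few_types (2 ^ d) (num_types d) k0) T ->
  (2 ^ d <= 3 * (minn s q * (minn s q).-1))%N.
Proof.
move=> le_n eps0 le_eps; apply: (sample_bound (t0 := num_types_gt0 d)).
  by rewrite card_ffun card_bool expn_gt0.
move=> c0 D [M [tau ->]].
have := emd_all_rows_num_types R k0 c0 (mxrows M tau) le_n; lra.
Qed.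

(** With [c = 2 ^ (d - 5)], [num_types d] is [2 ^ (4 * c)], the fourth power of [2 ^ c]; [n] is
    large enough since [4 * c + 3 <= 32 * c]. *)
Lemma few_types_query_bound (R : realType) (n d s q : nat)
    (k0 : (0 < #|'I_(2 ^ d)|)%N) (eps : R) (T : tester R n s q) :
  (6 <= d)%N -> (2 ^ (2 ^ d) <= n)%N -> 0 < eps -> eps <= 256^-1 ->
  is_tester eps (few_types (2 ^ d) (num_types d) k0) T ->
  ((2 ^ (2 ^ (d - 5))) ^ 4 <= 6 * (q * q.-1))%N.
Proof.
move=> d6 le_n eps0 le_eps testT.
have e1 : (2 ^ d = 32 * 2 ^ (d - 5))%N by rewrite -(expnD 2 5) subnKC// ltnW.
have e2 : num_types d = (2 ^ (4 * 2 ^ (d - 5)))%N.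
  by rewrite /num_types ltnNge d6/= -(expnD 2 2); congr (2 ^ (2 ^ _))%N; lia.
rewrite -expnM mulnC -e2; apply: (query_bound (c := (2 ^ (d - 5))%N)) testT => //.
  by rewrite expn_gt0.
apply: leq_trans le_n; rewrite e2 e1 -(expnD 2 _ 3) leq_exp2l//.
have : (0 < 2 ^ (d - 5))%N by rewrite expn_gt0.
lia.
Qed.

Theorem theorem6p1 (R : realType) :
  exists (eps0 c C : R), 0 < eps0 /\ 0 < c /\
    forall d n : nat, (2 ^ (2 ^ d) <= n)%N ->
      exists P : set (fdist R (cube n)),
        closed_property P /\ index_invariant P /\ property_vc_dim_le P d /\
        forall eps : R, 0 < eps -> eps <= eps0 ->
          forall (s q : nat) (T : tester R n s q), is_tester eps P T ->
            2 `^ (c * d%:R) <= s%:R /\ 2 `^ (2 `^ (d%:R - C)) <= q%:R.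
Proof.
(* [256^-1] is half of the distance bound [128^-1]; [4^-1] comes from [2 ^ d <= s ^ 4], and 5 from
   [2 ^ (2 ^ (d - 5))]. *)
exists 256^-1, 4^-1, 5; split; first lra.
split=> [|d n le_n]; first lra.
have k0 : (0 < #|'I_(2 ^ d)|)%N by rewrite card_ord expn_gt0.
exists (few_types (2 ^ d) (num_types d) k0).
split; first exact: few_types_closed.
split; first exact: few_types_index_invariant.
split; first exact: few_types_vc_dim.
move=> eps eps0 le_eps s q T testT.
have := few_types_sample_bound le_n eps0 le_eps testT.
set u := minn s q => le_du.
have u2 : (2 <= u)%N.
  have : (0 < 2 ^ d)%N by rewrite expn_gt0.
  by move: u le_du => [|[|u]] //; rewrite muln0; lia.
split.
  (* The fourth power absorbs the constant: [3 * (u * u.-1) <= u ^ 4] for [u >= 2]. *)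
  have le_ds : (2 ^ d <= s ^ 4)%N.
    have le_us : (u <= s)%N by exact: geq_minl.
    apply: (leq_trans le_du); apply: leq_trans (_ : u ^ 4 <= _)%N;
      last by rewrite leq_exp2r.
    rewrite (expnD u 2 2) -mulnn; apply: leq_mul;
      last by rewrite leq_mul2l leq_pred orbT.
    by apply: (@leq_trans (2 * 2)%N) => //; apply: leq_mul.
  rewrite -(@ler_pXn2r _ 4) ?nnegrE ?powR_ge0// -powR_mulrn ?powR_ge0// -powRrM.
  by rewrite mulrAC mulVf ?mul1r ?pnatr_eq0// powR_mulrn// -!natrX ler_nat.
have q2 : (2 <= q)%N by apply: leq_trans u2 _; exact: geq_minr.
have [d6|d6] := ltnP d 6.
  (* For [d <= 5] the claimed bound is at most 2, and [q >= 2] already follows from the sample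
     bound. *)
  apply: (@le_trans _ _ 2); last by rewrite ler_nat.
  have le1 : 2 `^ (d%:R - 5) <= 1 :> R.
    have /(ler_powR (ler1n R 2)) : d%:R - 5 <= 0 :> R by rewrite subr_le0 ler_nat.
    by rewrite powRr0.
  by have := ler_powR (ler1n R 2) le1; rewrite powRr1.
have := few_types_query_bound d6 le_n eps0 le_eps testT.
rewrite -natrB ?(ltnW d6)// powR_mulrn// -natrX powR_mulrn// -natrX ler_nat.
set f := (2 ^ (2 ^ (d - 5)))%N => le_fq.
have f4 : (4 <= f)%N.
  apply: (@leq_trans (2 ^ (2 ^ 1))%N) => //.
  by rewrite leq_exp2l// leq_exp2l// subn_gt0.
rewrite -(leq_exp2r _ _ (isT : (0 < 4)%N)); apply: (leq_trans le_fq).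
(* Absorbing the factor 6 into [q ^ 4] uses [q * q >= 9], so [q = 2] is excluded through
   [f >= 4]. *)
have q3 : (3 <= q)%N.
  have : (4 ^ 4 <= 6 * (q * q.-1))%N by rewrite (leq_trans _ le_fq)// leq_exp2r.
  by move: q q2 {testT T le_fq u2 le_du u} => [|[|[|q]]].
rewrite (expnD q 2 2) -!mulnn mulnA.
have : (9 <= q * q)%N by exact: (@leq_mul 3 3).
nia.
Qed.
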